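(* For all positive integers $m,n$, $$\sum_{k=1}^n (-1)^{k-1}\binom{2n}{n-k} k^{2m} = \frac{(-1)^{n-1}}{2} \sum_{\ell=0}^m \langle 2n\rangle_{2\ell}\binom{\ell}{2n-\ell}\sigma_{m,\ell}(n).$$
   Context: Falling factorial: $\langle x\rangle_0=1$ and $\langle x\rangle_j = x(x-1)\cdots(x-j+1)$ for positive integers $j$. Binomial coefficients $\binom{a}{b}$ with $b>a\ge 0$ integers are $0$. For nonnegative integers $\ell\le m$ and an indeterminate $y$, $\sigma_{m,\ell}(y)$ denotes the coefficient of $T^{m-\ell}$ in the formal power series $\prod_{j=0}^{\ell} \frac{1}{1-T(y-j)^2}$; equivalently $\sigma_{m,\ell}(y)=\sum_{0\le k_1\le\cdots\le k_{m-\ell}\le \ell}\prod_{i=1}^{m-\ell}(y-k_i)^2$. *)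

(* Defs.v *)
From HB Require Import structures.
From mathcomp Require Import all_boot all_order all_algebra.
Set Implicit Arguments.
Unset Strict Implicit.
Unset Printing Implicit Defensive.
Import GRing.Theory.
Local Open Scope ring_scope.

(* A formal power series over R is its coefficient function nat -> R. *)
Section FormalPowerSeries.
Variable R : comUnitRingType.
Implicit Types f g : nat -> R.

Definition fps_of_poly (p : {poly R}) : nat -> R := fun i => p`_i.

Definition fps_mul f g : nat -> R :=
  fun n => \sum_(i < n.+1) f i * g (n - i)%N.

(* The first n.+1 coefficients of the inverse of f, for f 0 a unit. *)
Fixpoint fps_inv_seq f n : seq R :=
  if n is n'.+1 then
    let s := fps_inv_seq f n' in
    rcons s (- ((f 0%N)^-1 * \sum_(i < n) f i.+1 * s`_(n' - i)))
  else [:: (f 0%N)^-1].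

Definition fps_inv f : nat -> R := fun n => (fps_inv_seq f n)`_n.

Lemma size_fps_inv_seq f n : size (fps_inv_seq f n) = n.+1.
Proof. by elim: n => //= n IHn; rewrite size_rcons IHn. Qed.

Lemma nth_fps_inv_seq f n i : (i <= n)%N -> (fps_inv_seq f n)`_i = fps_inv f i.
Proof.
elim: n => [|n IHn]; first by rewrite leqn0 => /eqP ->.
rewrite leq_eqVlt => /predU1P[-> // | lt_in].
by rewrite /= nth_rcons size_fps_inv_seq lt_in IHn.
Qed.

Lemma fps_mulV f : f 0%N \is a GRing.unit ->
  fps_mul f (fps_inv f) =1 fps_of_poly 1.
Proof.
move=> Uf [|n]; rewrite /fps_mul /fps_of_poly coef1.
  by rewrite big_ord_recl big_ord0 addr0 mulrV.
rewrite big_ord_recl subn0 {1}/fps_inv /= nth_rcons size_fps_inv_seq ltnn eqxx.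
rewrite mulrN mulVKr //; apply/eqP; rewrite addrC subr_eq0; apply/eqP.
apply: eq_bigr => i _; rewrite /bump leq0n add1n subSS nth_fps_inv_seq //.
exact: leq_subr.
Qed.

End FormalPowerSeries.

(* sigma m l is a polynomial in y, written 'X in {poly rat}. The series
   variable T is the indeterminate of {poly {poly rat}}, the second 'X below. *)
Definition sigma (m l : nat) : {poly rat} :=
  (\big[@fps_mul {poly rat}/fps_of_poly 1]_(0 <= j < l.+1)
     fps_inv (fps_of_poly (1 - (('X - j%:R) ^+ 2)%:P * 'X))) (m - l)%N.

(* Binomial coefficient with an integer lower index, 0 if it is negative. *)
Definition binz (a : nat) (b : int) : nat :=
  if b is Posz k then 'C(a, k) else 0%N.

(* Main.v *)
Require Import Defs.
From HB Require Import structures.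
From mathcomp Require Import all_boot all_order all_algebra.
From mathcomp Require Import ring zify.
Import GRing.Theory.
Local Open Scope ring_scope.

(** Since [(2 * n) ^_ (2 * l) = 0] for [l > n] and ['C(l, 2 * n - l) = 0] for
    [l < n], only the term [l = n] of the right-hand side survives.  Folding
    the left-hand side symmetrically, the theorem becomes
      [\sum_i (-1)^i 'C(2 * n, i) (n - i)^(2 * m)
         = (2 * n)`! h_(m - n) (0^2, 1^2, ..., n^2)],
    [h] being the complete homogeneous symmetric polynomial.  Up to the
    factorial, both sides satisfy the recurrence of the central factorial
    numbers, [T (n + 1, m + 1) = (n + 1)^2 T (n + 1, m) + T (n, m)]. *)

Lemma fps_inv_geometric {R : comUnitRingType} (c : R) (k : nat) :
  fps_inv (fps_of_poly (1 - c%:P * 'X)) k = c ^+ k.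
Proof.
set f := fps_of_poly _.
have fE i : f i = (i == 0%N)%:R - c * (i == 1%N)%:R.
  by rewrite /f /fps_of_poly coefB coef1 coefCM coefX.
have f0 : f 0%N = 1 by rewrite fE mulr0 subr0.
elim: k => [|k IHk]; first by rewrite /fps_inv /= f0 invr1.
(* The coefficient of [T^(k+1)] in [f * f^-1 = 1] has only two nonzero terms, since [f] has degree
   at most 1. *)
have := @fps_mulV _ f _ k.+1; rewrite f0 unitr1 => /(_ isT).
rewrite /fps_mul /fps_of_poly coef1 /= big_ord_recl big_ord_recl big1.
  rewrite f0 fE /bump /= subn0 subSS subn0 IHk mul1r addr0 mulr1 sub0r => /eqP.
  by rewrite mulNr subr_eq0 exprS => /eqP.
by move=> i _; rewrite fE /= mulr0 subr0 mul0r.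
Qed.

(* The coefficient of [T^k] is [h_k (c 0, ..., c (l - 1))]. *)
Definition geom_prod {R : comUnitRingType} (c : nat -> R) (l : nat) : nat -> R :=
  \big[@fps_mul R/fps_of_poly 1]_(0 <= j < l)
     fps_inv (fps_of_poly (1 - (c j)%:P * 'X)).

Lemma geom_prodS {R : comUnitRingType} (c : nat -> R) (l k : nat) :
  geom_prod c l.+1 k =
  \sum_(i < k.+1) c 0%N ^+ i * geom_prod (fun j => c j.+1) l (k - i)%N.
Proof.
rewrite /geom_prod big_nat_recl // {1}/fps_mul.
by apply: eq_bigr => i _; rewrite fps_inv_geometric.
Qed.

Lemma geom_prod_eq {R : comUnitRingType} (c d : nat -> R) (l : nat) :
  c =1 d -> geom_prod c l =1 geom_prod d l.
Proof.
elim: l c d => [|l IHl] c d eq_cd k; first by rewrite /geom_prod !big_geq.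
rewrite !geom_prodS; apply: eq_bigr => i _.
by rewrite eq_cd (IHl _ (fun j => d j.+1)).
Qed.

Lemma geom_prod0 {R : comUnitRingType} (c : nat -> R) (l : nat) :
  geom_prod c l 0 = 1.
Proof.
elim: l c => [|l IHl] c; first by rewrite /geom_prod big_geq // /fps_of_poly coef1.
by rewrite geom_prodS big_ord1 IHl mulr1.
Qed.

(** Monomials of degree [k + 1] are split according to whether they contain [c 0]. *)
Lemma geom_prod_rec {R : comUnitRingType} (c : nat -> R) (l k : nat) :
  geom_prod c l.+1 k.+1 =
  c 0%N * geom_prod c l.+1 k + geom_prod (fun j => c j.+1) l k.+1.
Proof.
rewrite !geom_prodS big_ord_recl mul1r subn0 addrC; congr (_ + _).
rewrite big_distrr; apply: eq_bigr => i _ /=.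
by rewrite /bump add1n subSS exprS mulrA.
Qed.

(** Used to evaluate [sigma] at [n]. [R] is an integral domain so that [{poly R}] is a
    [comUnitRingType], as [geom_prod] requires. *)
Lemma horner_geom_prod {R : idomainType} (c : nat -> {poly R}) (x : R)
    (l k : nat) :
  (geom_prod c l k).[x] = geom_prod (fun j => (c j).[x]) l k.
Proof.
elim: l c k => [|l IHl] c k.
  by rewrite /geom_prod !big_geq // /fps_of_poly !coef1; case: eqP; rewrite hornerE.
rewrite !geom_prodS horner_sum; apply: eq_bigr => i _.
by rewrite hornerM horner_exp IHl.
Qed.

(** The central difference of order [2n] of [x^(2m)] at 0, that is, [(2n)!] times a central
    factorial number of the second kind. *)
Definition central_diff (R : comUnitRingType) (n m : nat) : R :=
  \sum_(i < (2 * n).+1)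
     (-1) ^+ i * 'C(2 * n, i)%:R * (n%:R - i%:R) ^+ (2 * m).

Lemma central_diff0r (R : comUnitRingType) (n : nat) :
  central_diff R n 0 = (n == 0%N)%:R.
Proof.
have <- : (1 - 1 : R) ^+ (2 * n) = (n == 0%N)%:R.
  by rewrite subrr expr0n muln_eq0.
rewrite exprBn /central_diff; apply: eq_bigr => i _.
by rewrite !expr1n !mulr1 mulr_natr.
Qed.

Lemma central_diff0l (R : comUnitRingType) (m : nat) :
  central_diff R 0 m.+1 = 0.
Proof. by rewrite /central_diff big_ord1 subrr mulnS expr0n mulr0. Qed.

(** Absorption is applied to the lower index, then to the complementary one. *)
Lemma mul_bin_sides (N j : nat) : (j <= N)%N ->
  (j.+1 * (N.+1 - j) * 'C(N.+2, j.+1) = N.+2 * N.+1 * 'C(N, j))%N.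
Proof.
move=> le_jN; rewrite mulnAC -(mul_bin_diag N.+2) -!mulnA /=.
by rewrite (mulnC 'C(_, _)) -(mul_bin_down N.+1).
Qed.

(* [(n + 1 - i)^2 = (n + 1)^2 - i (2n + 2 - i)], and the last product is
   absorbed by the binomial coefficient. *)
Lemma central_diff_rec (R : comUnitRingType) (n m : nat) :
  central_diff R n.+1 m.+1 =
  n.+1%:R ^+ 2 * central_diff R n.+1 m
  + ((2 * n).+2 * (2 * n).+1)%:R * central_diff R n m.
Proof.
rewrite /central_diff; have -> : (2 * n.+1 = (2 * n).+2)%N by lia.
set N := (2 * n)%N.
pose g (i : nat) : R := (-1) ^+ i * (i%:R * (N.+2%:R - i%:R) * 'C(N.+2, i)%:R)
  * (n.+1%:R - i%:R) ^+ (2 * m).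
transitivity (n.+1%:R ^+ 2 * (\sum_(i < N.+3)
     (-1) ^+ i * 'C(N.+2, i)%:R * (n.+1%:R - i%:R) ^+ (2 * m))
     - \sum_(i < N.+3) g i).
  rewrite big_distrr -sumrB; apply: eq_bigr => i _.
  rewrite /g mulnS exprD /=.
  have -> : N.+2%:R = 2%:R * n.+1%:R :> R by rewrite -natrM; congr _%:R; lia.
  ring.
(* [g] vanishes at both ends, [0] and [N + 2]; the other indices, shifted by one, run over the range
   of [central_diff R n m], and the shift in the sign absorbs the minus. *)
congr (_ + _); rewrite big_ord_recl big_ord_recr /=.
rewrite {1}/g mul0r mul0r mulr0 mul0r add0r.
rewrite {2}/g /bump add1n subrr mulr0 mul0r mulr0 mul0r addr0.
rewrite -sumrN big_distrr; apply: eq_bigr => i _.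
rewrite /g add1n; have le_iN : (i <= N)%N by rewrite -ltnS.
rewrite -natrB ?ltnS ?(leqW le_iN) // subSS -!natrM mul_bin_sides // natrM.
have -> : n.+1%:R - i.+1%:R = n%:R - i%:R :> R by rewrite -!natr1; ring.
rewrite exprS /=; ring.
Qed.

Lemma central_diffE (R : comUnitRingType) (n m : nat) :
  central_diff R n m =
  if (n <= m)%N
  then (2 * n)`!%:R * geom_prod (fun j => (n%:R - j%:R) ^+ 2) n.+1 (m - n)
  else 0.
Proof.
elim: m n => [|m IHm] [|n]; rewrite ?central_diff0r ?central_diff0l ?ltnS //=.
- by rewrite geom_prod0 mulr1.
(* For [n = 0] the only entry is [0], so the series is the constant 1. *)
- rewrite geom_prodS big1 ?mulr0 // => i _.
  case: i => [[|i] lti] /=.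
    by rewrite /geom_prod big_geq // /fps_of_poly coef1 mulr0.
  by rewrite subrr expr0n /= exprS !mul0r.
rewrite central_diff_rec !IHm.
have fact2S : (2 * n.+1)`! = ((2 * n).+2 * (2 * n).+1 * (2 * n)`!)%N.
  by rewrite mulnS add2n !factS mulnA.
(* For [n < m], [geom_prod_rec] peels off the entry [(n + 1)^2] and leaves
   [(n + 1) - (j + 1) = n - j]. For [n = m] only the second term of the recurrence survives. *)
case: (ltngtP n m) => [lt_nm | _ | <-].
- rewrite subSS -(subnSK lt_nm) [in RHS]geom_prod_rec subr0 fact2S.
  rewrite (@geom_prod_eq _ (fun j => (n.+1%:R - j.+1%:R) ^+ 2)
    (fun j => (n%:R - j%:R) ^+ 2)).
    rewrite !natrM; ring.
  by move=> j; rewrite -!natr1; congr (_ ^+ 2); ring.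
- by rewrite !mulr0 addr0.
by rewrite !subnn !geom_prod0 fact2S !mulr1 mulr0 add0r -natrM.
Qed.

(** The terms [i = n - k] and [i = n + k] are equal, and the middle one is 0 because [m > 0]. *)
Lemma central_diff_half (R : comUnitRingType) (m n : nat) : (0 < m)%N ->
  central_diff R n m = 2%:R * \sum_(1 <= k < n.+1)
    (-1) ^+ (n - k) * 'C(2 * n, n - k)%:R * k%:R ^+ (2 * m).
Proof.
move=> m_gt0.
pose g i : R := (-1) ^+ i * 'C(2 * n, i)%:R * (n%:R - i%:R) ^+ (2 * m).
rewrite /central_diff -(big_mkord xpredT g).
rewrite (@big_cat_nat _ _ _ n) //=; last by lia.
rewrite [X in _ + X]big_ltn; last by lia.
have -> : g n = 0.
  by rewrite /g subrr expr0n muln_eq0 /= -[m == 0%N]negbK -lt0n m_gt0 mulr0.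
rewrite add0r mulr_natl mulr2n; congr (_ + _).
  rewrite big_nat_rev big_add1 /=; apply: eq_big_nat => k /andP[_ ltkn].
  by rewrite add0n /g natrB // opprB addrC subrK.
have -> : (2 * n).+1 = (n.+1 + n)%N by lia.
rewrite -{1}[n.+1]add1n big_addn.
have -> : (n.+1 + n - n = n.+1)%N by lia.
apply: eq_big_nat => k /andP[_ ltkn]; rewrite /g.
rewrite natrD opprD addrCA subrr addr0 exprM sqrrN -exprM.
rewrite -(@bin_sub _ (n - k)%N); last by lia.
have -> : (2 * n - (n - k) = k + n)%N by lia.
(* The exponents [k + n] and [n - k] have the same parity. *)
rewrite -[in LHS]signr_odd -[in RHS]signr_odd oddB // oddD.
by rewrite addbC.
Qed.

Theorem theorem6 (m n : nat) (hm : (0 < m)%N) (hn : (0 < n)%N) :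
  \sum_(1 <= k < n.+1)
     (-1) ^+ (k - 1) * ('C(2 * n, n - k))%:R * k%:R ^+ (2 * m)
  = (-1) ^+ (n - 1) / 2%:R *
    \sum_(0 <= l < m.+1)
       ((2 * n) ^_ (2 * l))%:R * (binz l ((2 * n)%N%:Z - l%:Z))%:R
         * (sigma m l).[n%:R] :> rat.
Proof.
have -> : \sum_(0 <= l < m.+1)
    ((2 * n) ^_ (2 * l))%:R * (binz l ((2 * n)%N%:Z - l%:Z))%:R
      * (sigma m l).[n%:R] = central_diff rat n m.
  have sigmaE : (sigma m n).[n%:R]
      = geom_prod (fun j => (n%:R - j%:R : rat) ^+ 2) n.+1 (m - n).
    rewrite /sigma -/(geom_prod (fun j => ('X - j%:R) ^+ 2) _ _) horner_geom_prod.
    apply: geom_prod_eq => j.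
    by rewrite horner_exp hornerD hornerN hornerX hornerMn hornerC.
  rewrite central_diffE -sigmaE.
  have vanish l : l != n ->
      ((2 * n) ^_ (2 * l))%:R * (binz l ((2 * n)%N%:Z - l%:Z))%:R
        * (sigma m l).[n%:R] = 0 :> rat.
    rewrite neq_ltn => /orP[lt_ln | lt_nl]; last first.
      by rewrite ffact_small ?mul0r //; lia.
    rewrite subzn; last by lia.
    by rewrite /= bin_small ?mulr0 ?mul0r //; lia.
  (* The index [l = n] lies in the range exactly when [n <= m]; otherwise every term vanishes. *)
  case: leqP => [le_nm | lt_mn].
    rewrite big_mkord (bigD1 (Ordinal (le_nm : (n < m.+1)%N))) //= big1 ?addr0.
      rewrite subzn; last by lia.
      have -> : (2 * n - n = n)%N by lia.
      by rewrite /= binn ffactnn mulr1.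
    by move=> l; rewrite -val_eqE => /vanish.
  by rewrite big_nat big1 // => l /andP[_ ltlm]; apply: vanish; lia.
(* The factors 2 cancel, and [(n - 1) + (n - k)] has the parity of [k - 1]. *)
rewrite central_diff_half // mulrA mulfVK // big_distrr.
apply: eq_big_nat => k /andP[k_gt0 ltkn] /=; rewrite !mulrA -exprD.
congr (_ * _ * _); rewrite -[LHS]signr_odd -[RHS]signr_odd.
by congr (_ ^+ nat_of_bool _); lia.
Qed.
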